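(* Let $(X,f,x_0)$ be a minimal counting system and let $\#$ be the unique iterator for $(X,f,x_0)$. There exists a unique binary operation $\oplus$ on $X$ such that \[ \#(A) \oplus \#(B) = \#(A \cup B) \] whenever $A$ and $B$ are disjoint finite sets. This operation $\oplus$ is both associative and commutative, $x \oplus x_0 = x$ for all $x \in X$, and for all $x_1, x_2 \in X$ there is an $x \in X$ such that either $x_1 = x_2 \oplus x$ or $x_2 = x_1 \oplus x$. Moreover, $\oplus$ is the unique binary operation on $X$ such that (a0) $x \oplus x_0 = x$ for all $x \in X$; (a1) $x \oplus f(x') = f(x \oplus x')$ for all $x, x' \in X$.
   Context: For a set $A$ let $\mathcal{P}(A)$ denote its power set. A subset $\mathcal{K} \subset \mathcal{P}(A)$ is an inductive system in $\mathcal{P}(A)$ if $\varnothing \in \mathcal{K}$ and $B \cup \{a\} \in \mathcal{K}$ for all $B \in \mathcal{K}$ and $a \in A \setminus B$. A set $A$ is finite if $\mathcal{P}(A)$ itself is the only inductive system in $\mathcal{P}(A)$. Sets are those of ordinary set theory; in particular for every set $A$ there is an element not in $A$. A counting system is a triple $(X,f,x_0)$ with $X$ a set, $f : X \to X$ a mapping and $x_0 \in X$. A subset $Y \subset X$ is $f$-invariant if $f(Y) \subset Y$. The counting system is minimal if the only $f$-invariant subset of $X$ containing $x_0$ is $X$ itself. An iterator for $(X,f,x_0)$ is an assignment $A \mapsto \#(A)$ of an element of $X$ to each finite set $A$ such that $\#(\varnothing) = x_0$ and $\#(A \cup \{a\}) = f(\#(A))$ whenever $A$ is a finite set and $a \notin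 A$. Each counting system has a unique iterator. *)

(* Defs.v *)
From mathcomp Require Import all_boot.
From mathcomp Require Import boolp classical_sets.

Set Implicit Arguments.
Unset Strict Implicit.
Unset Printing Implicit Defensive.

Local Open Scope classical_set_scope.

(* [U] is the domain of all elements; a set is a [set U], and a finite one is
   finite in the sense below, without reference to the natural numbers. *)
Section FiniteSets.
Variable U : Type.
Implicit Types (A B C : set U) (K : set (set U)).

Definition powerset A : set (set U) := [set B | B `<=` A].

Definition inductive_system A K : Prop :=
  [/\ K `<=` powerset A,
      K set0
    & forall B a, K B -> (A `\` B) a -> K (B `|` [set a])].

Definition is_finite A : Prop :=
  forall K, inductive_system A K -> K = powerset A.

Record fin_set := FinSet {
  fin_carrier :> set U;
  fin_setP : is_finite fin_carrier }.
Arguments fin_setP : clear implicits.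

Lemma is_finite0 : is_finite set0.
Proof.
move=> K [Ksub K0 _]; apply/seteqP; split=> // B.
by rewrite /powerset/= subset0 => ->.
Qed.

Lemma is_finite_ind A K : is_finite A -> K set0 ->
  (forall B a, B `<=` A -> K B -> (A `\` B) a -> K (B `|` [set a])) ->
  forall B, B `<=` A -> K B.
Proof.
move=> finA K0 KS B BA.
have -> // : K B = True.
have E : [set C | C `<=` A /\ K C] = powerset A.
  apply: finA; split=> [C []// | | C a [CA KC] [Aa nCa]].
    by split=> // x.
  split; first by move=> x [/CA//|->].
  exact: KS.
have : powerset A B by [].
by rewrite -E => -[_ KB]; rewrite propeqE.
Qed.

Lemma is_finiteU1 A a : is_finite A -> is_finite (A `|` [set a]).
Proof.
move=> finA K [Ksub K0 KS]; apply/seteqP; split=> // C CA.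
have Ka B b : K B -> (A `|` [set a]) b -> K (B `|` [set b]).
  move=> KB Ab; have [Bb|nBb] := pselect (B b).
    by rewrite (_ : B `|` [set b] = B)//; apply/seteqP; split=> x;
       [case=> // -> | left].
  exact: KS.
have KA B : B `<=` A -> K B /\ K (B `|` [set a]).
  move: B; apply: (@is_finite_ind A (fun B => K B /\ K (B `|` [set a]))) => //.
    by split=> //; apply: Ka => //; right.
  move=> B b BA [KB KBa] [Ab nBb]; split; first by apply: Ka => //; left.
  by apply: (Ka _ a); [apply: Ka => //; left | right].
have CaA : C `\` [set a] `<=` A by move=> x [/CA []].
have [KC KCa] := KA _ CaA.
have [Ca|nCa] := pselect (C a).
  by rewrite -(@setDUK _ [set a] C) 1?setUC// => _ ->.
rewrite (_ : C = C `\` [set a])//; apply/seteqP; split=> x //=; last by case.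
by move=> Cx; split=> // xa; apply: nCa; rewrite -xa.
Qed.

Lemma is_finite1 a : is_finite [set a].
Proof. by rewrite -[X in is_finite X]set0U; exact/is_finiteU1/is_finite0. Qed.

Arguments is_finite1 : clear implicits.

Lemma is_finiteU A B : is_finite A -> is_finite B -> is_finite (A `|` B).
Proof.
move=> finA finB.
apply: (@is_finite_ind B (fun C => is_finite (A `|` C))) => //.
  by rewrite setU0.
by move=> C b _ finAC _; rewrite setUA; exact: is_finiteU1.
Qed.

Definition fin0 : fin_set := FinSet is_finite0.
Definition fin1 (a : U) : fin_set := FinSet (is_finite1 a).
Definition finU (A B : fin_set) : fin_set :=
  FinSet (is_finiteU (fin_setP A) (fin_setP B)).

End FiniteSets.

Arguments fin0 {U}.

(* A counting system [(X, f, x0)] is given by a type [X], [f : X -> X] and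
   [x0 : X]. *)
Section CountingSystems.
Variables (X : Type) (f : X -> X) (x0 : X).

Definition invariant_set (Y : set X) : Prop := f @` Y `<=` Y.

Definition minimal_counting_system : Prop :=
  forall Y : set X, invariant_set Y -> Y x0 -> Y = setT.

Definition is_iterator (U : Type) (card : fin_set U -> X) : Prop :=
  card fin0 = x0 /\
  forall (A : fin_set U) (a : U), ~ (A : set U) a ->
    card (finU A (fin1 a)) = f (card A).

End CountingSystems.

(* Main.v *)
(** For a minimal counting system, the points [x] such that some map [g]
commuting with [f] sends [x0] to [x] form an [f]-invariant set containing
[x0] (witnesses [id] and [f \o g]), hence every point is such. Choosing
[op x] to be such a [g] yields (a0) and (a1) without any injectivity of [f].
Minimality makes [g] unique, so commutativity and associativity follow by
comparing maps commuting with [f], and [op] counts disjoint unions by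
induction on finite sets. *)
Require Import Defs.
From mathcomp Require Import all_boot.
From mathcomp Require Import boolp classical_sets.

Local Open Scope classical_set_scope.

Lemma fin_set_inj (U : Type) (A B : fin_set U) :
  A = B :> set U -> A = B.
Proof.
case: A B => [A finA] [B finB] /= AB; subst B.
by rewrite (Prop_irrelevance finA finB).
Qed.

Section MinimalSystem.
Context {X : Type} {f : X -> X} {x0 : X}.
Hypothesis minX : minimal_counting_system f x0.

Lemma minimal_ind (P : X -> Prop) :
  P x0 -> (forall x, P x -> P (f x)) -> forall x, P x.
Proof.
move=> P0 PS x.
have PT : [set y | P y] = setT by apply: minX => // _ [y Py <-]; exact: PS.
by have : [set y | P y] x by rewrite PT.
Qed.

(** The points where [g] and [h] agree form an [f]-invariant set containing [x0]. *)
Lemma commuting_ext (g h : X -> X) :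
  (forall x, g (f x) = f (g x)) -> (forall x, h (f x) = f (h x)) ->
  g x0 = h x0 -> g =1 h.
Proof. by move=> gf hf gh; apply: minimal_ind => // x; rewrite gf hf => ->. Qed.

Lemma commuting_exists (x : X) :
  exists g : X -> X, g x0 = x /\ forall y, g (f y) = f (g y).
Proof.
move: x; apply: minimal_ind => [|x [g [<- gf]]]; first by exists id.
by exists (f \o g); split=> // y /=; rewrite gf.
Qed.

Lemma minimal_x0_or_succ (x : X) : x = x0 \/ exists x', x = f x'.
Proof. by move: x; apply: minimal_ind => [|x _]; [left | right; exists x]. Qed.

(** Equivalently, each [op x] commutes with [f] and sends [x0] to [x]. *)
Definition addition_laws (op : X -> X -> X) : Prop :=
  (forall x, op x x0 = x) /\ (forall x x', op x (f x') = f (op x x')).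

Lemma addition_exists : exists op, addition_laws op.
Proof.
have [op opP] := choice commuting_exists.
by exists op; split=> x; have [] := opP x.
Qed.

Lemma addition_uniq (op op' : X -> X -> X) :
  addition_laws op -> addition_laws op' -> op = op'.
Proof.
move=> [op0 opS] [op'0 op'S]; apply/funext => x; apply/funext.
by apply: commuting_ext => //; rewrite op0 op'0.
Qed.

Section Addition.
Variable op : X -> X -> X.
Hypothesis opP : addition_laws op.

Lemma add0x (x : X) : op x0 x = x.
Proof.
have [op0 opS] := opP.
by move: x; apply: (commuting_ext (op x0) id).
Qed.

Lemma addSx (x y : X) : op (f x) y = f (op x y).
Proof.
have [op0 opS] := opP; move: y; apply: commuting_ext => // [y|].
  by rewrite opS.
by rewrite !op0.
Qed.

Lemma addition_comm : commutative op.
Proof.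
have [op0 opS] := opP; move=> x; apply: commuting_ext => // [y|].
  exact: addSx.
by rewrite op0 add0x.
Qed.

Lemma addition_assoc : associative op.
Proof.
have [op0 opS] := opP.
move=> x y; apply: commuting_ext => // [z|]; first by rewrite !opS.
by rewrite !op0.
Qed.

Lemma addition_total (x1 x2 : X) :
  exists x, x1 = op x2 x \/ x2 = op x1 x.
Proof.
have [op0 opS] := opP.
move: x1; apply: minimal_ind => [|x1 [x [->|->]]].
- by exists x2; right; rewrite add0x.
- by exists (f x); left; rewrite opS.
(* Here [x2 = op x1 x]. Passing from [x1] to [f x1] removes one [f] from the difference [x]; if
   [x = x0] there is none to remove, and [f x1] exceeds [x2] by [f x0]. *)
have [->|[x' ->]] := minimal_x0_or_succ x.
  by exists (f x0); left; rewrite opS !op0.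
by exists x'; right; rewrite opS addSx.
Qed.

Lemma card_finU (U : Type) (card : fin_set U -> X) (A B : fin_set U) :
  is_iterator f x0 card -> A `&` B = set0 ->
  op (card A) (card B) = card (finU A B).
Proof.
have [op0 opS] := opP.
move=> [card0 cardS] AB0.
(* The induction runs over bare subsets of [B], while [card] takes bundled finite sets, so [K]
   carries the finiteness proof along. *)
pose K (C : set U) := exists finC : is_finite C,
  op (card A) (card (Defs.FinSet finC)) = card (finU A (Defs.FinSet finC)).
suff /(_ B (@subset_refl _ _)) [finB] : forall C : set U, C `<=` B -> K C.
  by rewrite (_ : Defs.FinSet finB = B)//; exact: fin_set_inj.
apply: (@is_finite_ind U B K (@fin_setP U B)) => [|C b CB [finC IH] [Bb nCb]].
  exists (@is_finite0 U); rewrite -/fin0 card0 op0; congr card.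
  by apply: fin_set_inj; rewrite /= setU0.
exists (is_finiteU1 finC).
rewrite (_ : Defs.FinSet _ = finU (Defs.FinSet finC) (fin1 b));
  last exact: fin_set_inj.
(* Disjointness of [A] and [B] keeps [b] out of the union of [A] and [C], so adjoining [b] applies
   [f] on both sides. *)
rewrite cardS// opS IH -(cardS _ b); last first.
  by case=> // Ab; have : (A `&` B) b by []; rewrite AB0.
by congr card; apply: fin_set_inj; rewrite /= setUA.
Qed.

End Addition.

(** A fresh element outside both [A] and [B] can be adjoined to [B], which replaces its count by the
    image under [f]. *)
Lemma card_surj_disjoint (U : Type) (card : fin_set U -> X) (A : fin_set U) :
  (forall B : fin_set U, exists a, ~ (B : set U) a) ->
  is_iterator f x0 card ->
  forall x, exists B : fin_set U, A `&` B = set0 /\ card B = x.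
Proof.
move=> fresh [card0 cardS]; apply: minimal_ind => [|_ [B [AB0 <-]]].
  by exists fin0; rewrite /= setI0.
have [a /not_orP[nAa nBa]] := fresh (finU A B).
exists (finU B (fin1 a)); split; last exact: cardS.
rewrite /= setIUr AB0 set0U; apply/seteqP; split=> // x [Ax xa].
by apply: nAa; rewrite -xa.
Qed.

End MinimalSystem.

Theorem theorem5p1 (U : Type)
    (* outside every finite set there is a further element *)
    (fresh : forall A : fin_set U, exists a : U, ~ (A : set U) a)
    (X : Type) (f : X -> X) (x0 : X)
    (minX : minimal_counting_system f x0)
    (card : fin_set U -> X) (cardP : is_iterator f x0 card) :
  exists oplus : X -> X -> X,
    [/\ unique (fun op : X -> X -> X =>
          forall A B : fin_set U, A `&` B = set0 ->
            op (card A) (card B) = card (finU A B)) oplus,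
        associative oplus /\ commutative oplus,
        forall x : X, oplus x x0 = x,
        forall x1 x2 : X, exists x : X, x1 = oplus x2 x \/ x2 = oplus x1 x
      & unique (fun op : X -> X -> X =>
          (forall x : X, op x x0 = x) /\
          (forall x x' : X, op x (f x') = f (op x x'))) oplus].
Proof.
have [op opP] := addition_exists minX.
exists op; split.
- split=> [A B|op' op'P]; first by exact: (card_finU op opP).
  apply/funext => x; apply/funext => y.
  (* Any pair [x], [y] is realised as the counts of two disjoint finite sets, where the counting
     identity determines the operation. *)
  have [A [_ <-]] := card_surj_disjoint minX U card fin0 fresh cardP x.
  have [B [AB0 <-]] := card_surj_disjoint minX U card A fresh cardP y.
  by rewrite op'P// (card_finU op opP U card).
- split; first exact: (addition_assoc minX op opP).
  exact: (addition_comm minX op opP).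
- by case: opP.
- exact: (addition_total minX op opP).
by split=> // op'; exact: (addition_uniq minX).
Qed.
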